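(* Let $n\ge1$. If $H$ is dense in $\widehat{\mathcal F_n}$, then a $\sqcup$-irreducible element of $H$ remains $\sqcup$-irreducible in $\widehat{\mathcal F_n}$.
   Context: Fix $n\ge1$ and symbols $P_1,\dots,P_n$. The partially ordered set $(K_n,\le)$ with valuation map $\mathrm{val}:K_n\to\mathfrak P(\{P_1,\dots,P_n\})$ is the increasing union of finite sets $K_n^d$ ($d\ge 0$) built recursively: $K_n^{-1}=\emptyset$, and $K_n^d\setminus K_n^{d-1}$ consists of exactly one point $w_{\beta,Y}$ for each pair $(\beta,Y)$ such that (i) $Y$ is a decreasing subset of $K_n^{d-1}$ with $Y\not\subseteq K_n^{d-2}$ (for $d=0$ this last condition is void, so $Y=\emptyset$); (ii) $\beta\subseteq\{P_1,\dots,P_n\}$ and $\beta\subseteq\mathrm{val}(w')$ for all $w'\in Y$; (iii) if $Y$ is the decreasing set generated by a single element $w_{\beta',Y'}$, then $\beta\ne\beta'$. One sets $\mathrm{val}(w_{\beta,Y})=\beta$, and $w\le w_{\beta,Y}$ iff $w\in Y$ or $w=w_{\beta,Y}$. $\widehat{\mathcal F_n}:=\mathcal O_\downarrow(K_n,\le)$ is the Heyting algebra of all decreasing subsets of $K_n$ ($\sqcap=\cap$, $\sqcup=\cup$, $a\to b$ = the largest decreasing set contained in $(K_n\setminus a)\cup b$). It carries the metric $\mathrm d(a,b)=2^{-\min\{i\in\mathbb N\mid a\cap K_n^i\neq b\cap K_n^i\}}$ ($2^{-\min\emptyset}=0$). ''$H$ is dense in $\widehat{\mathcal F_n}$'' means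 that $H$ is a Heyting sub-algebra of $\widehat{\mathcal F_n}$ that is dense for this metric. An element $a$ of a lattice is $\sqcup$-irreducible if $a\ne0$ and $a$ cannot be written as $b_1\sqcup b_2$ with $b_1\neq a$ and $b_2\ne a$. *)

(* Defs.v *)
From HB Require Import structures.
From mathcomp Require Import all_boot all_order all_algebra finmap.
From mathcomp Require Import all_classical all_reals all_analysis.

Set Implicit Arguments.
Unset Strict Implicit.
Unset Printing Implicit Defensive.

Import Order.TTheory GRing.Theory Num.Theory.

(* The symbol P_{i+1} is i : 'I_n.  A code [Pt beta s] stands for w_{beta,Y}
   with Y the set of entries of s.  Only the codes [wpt beta Y] below, in which s
   is the canonical enumeration of the finite set Y, enter the construction, so
   that points and pairs (beta, Y) correspond bijectively. *)
Inductive pt (n : nat) : Type := Pt of {set 'I_n} & seq (pt n).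

Section PtChoice.
Variable n : nat.

Fixpoint pt_code (x : pt n) : GenTree.tree {set 'I_n} :=
  let: Pt b s := x in GenTree.Node 0 (GenTree.Leaf b :: map pt_code s).

Fixpoint pt_decode (t : GenTree.tree {set 'I_n}) : pt n :=
  if t is GenTree.Node _ (GenTree.Leaf b :: ts) then Pt b (map pt_decode ts)
  else Pt finset.set0 [::].

Lemma pt_codeK : cancel pt_code pt_decode.
Proof.
rewrite /cancel; fix IH 1 => -[b s] /=; congr Pt.
by elim: s => //= x s ->; rewrite IH.
Qed.

HB.instance Definition _ := Equality.copy (pt n) (can_type pt_codeK).
HB.instance Definition _ := Choice.copy (pt n) (can_type pt_codeK).
HB.instance Definition _ := Countable.copy (pt n) (can_type pt_codeK).

End PtChoice.

Section Construction.
Variable n : nat.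
Local Open Scope fset_scope.

Definition wpt (beta : {set 'I_n}) (Y : {fset pt n}) : pt n :=
  Pt beta (enum_fset Y).

Definition pt_val (x : pt n) : {set 'I_n} := let: Pt b _ := x in b.

Definition pt_below (x : pt n) : seq (pt n) := let: Pt _ s := x in s.

Definition pt_le (x y : pt n) : bool := (x \in pt_below y) || (x == y).

Definition fdecreasing (B Y : {fset pt n}) : bool :=
  [forall y : Y, forall x : B, pt_le (val x) (val y) ==> (val x \in Y)].

(* Conditions (i)-(iii), with B = K_n^{d-1}, and oldA = Some K_n^{d-2} or, when
   d = 0, oldA = None. *)
Definition admissible (oldA : option {fset pt n}) (B : {fset pt n})
    (beta : {set 'I_n}) (Y : {fset pt n}) : bool :=
  [&& Y `<=` B, fdecreasing B Y,
      (if oldA is Some A then ~~ (Y `<=` A) else true),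
      [forall y : Y, beta \subset pt_val (val y)] &
      [forall y : B, (Y == [fset x in B | pt_le x (val y)]) ==>
                     (beta != pt_val (val y))]].

(* The index is shifted by one: Kpre d.+1 is K_n^d and Kpre 0 is K_n^{-1}. *)
Fixpoint Kpre (k : nat) : {fset pt n} :=
  if k is k'.+1 then
    let B := Kpre k' in
    let oldA := if k' is k''.+1 then Some (Kpre k'') else None in
    B `|` [fset wpt beta Y | beta in powerset [set: 'I_n]%SET,
             Y in [fset Y in fpowerset B | admissible oldA B beta Y]]
  else fset0.

Definition Kfin (d : nat) : {fset pt n} := Kpre d.+1.

Lemma in_KpreS k x : reflect
  (x \in Kpre k \/ exists2 p : {set 'I_n} * {fset pt n}, x = wpt p.1 p.2 &
    admissible (if k is k''.+1 then Some (Kpre k'') else None) (Kpre k) p.1 p.2)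
  (x \in Kpre k.+1).
Proof.
apply: (iffP (fsetUP _ _ _)) => -[xK|]; [by left| |by left|].
  case/imfset2P => b _ [Y]; rewrite !inE /= => /andP[_ adm] ->.
  by right; exists (b, Y).
case=> -[b Y] /= -> adm; right; apply/imfset2P; exists b; first by rewrite !inE.
by exists Y => //; rewrite !inE /= fpowersetE adm andbT; case/andP: adm.
Qed.

Lemma Kpre_below k x : x \in Kpre k -> {subset pt_below x <= Kpre k}.
Proof.
elim: k x => [|k IH] x; first by rewrite inE.
case/in_KpreS => [xK y yx|[[b Y] -> /= adm] y /= yY].
  by apply/in_KpreS; left; apply: IH xK _ yx.
by apply/in_KpreS; left; case/andP: adm => /fsubsetP YB _; apply: YB.
Qed.

Lemma Kpre_trans k x y z :
  z \in Kpre k -> pt_le x y -> pt_le y z -> pt_le x z.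
Proof.
elim: k x y z => [|k IH] x y z; first by rewrite inE.
case/in_KpreS => [zK|[[b Y] -> /= adm]]; first exact: IH zK.
move=> xy /orP[/= yY|/eqP <-//]; apply/orP; left => /=.
case/and5P: adm => /fsubsetP YB dY _ _ _.
have xK : x \in Kpre k.
  case/orP: xy => [xy|/eqP ->]; last exact: YB.
  exact: (Kpre_below (YB _ yY)) xy.
by move/forallP: dY => /(_ [` yY]) /forallP /(_ [` xK]) /implyP; apply.
Qed.

End Construction.

Fixpoint pt_size n (x : pt n) : nat :=
  let: Pt _ s := x in (sumn (map (@pt_size n) s)).+1.

Lemma pt_below_size n (x y : pt n) : x \in pt_below y -> pt_size x < pt_size y.
Proof.
case: y => b s /= xs; rewrite ltnS.
elim: s xs => //= y s IH; rewrite inE => /orP[/eqP <-|/IH xs].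
  exact: leq_addr.
exact: leq_trans xs (leq_addl _ _).
Qed.

Lemma pt_le_anti n : antisymmetric (@pt_le n).
Proof.
move=> x y /andP[/orP[xy|/eqP //] /orP[yx|/eqP //]].
by have := ltn_trans (pt_below_size xy) (pt_below_size yx); rewrite ltnn.
Qed.

Section Poset.
Variable n : nat.

Definition in_K : pred (pt n) := fun x => `[< exists d, x \in Kfin n d >].

Definition K := {x : pt n | in_K x}.
HB.instance Definition _ := [isSub of K for @sval (pt n) in_K].
HB.instance Definition _ := [Countable of K by <:].

Definition K_val (x : K) : {set 'I_n} := pt_val (val x).

Definition K_le (x y : K) : bool := pt_le (val x) (val y).

Lemma K_le_refl : reflexive K_le.
Proof. by move=> x; rewrite /K_le /pt_le eqxx orbT. Qed.

Lemma K_le_anti : antisymmetric K_le.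
Proof. by move=> x y /pt_le_anti /val_inj. Qed.

Lemma K_le_trans : transitive K_le.
Proof. by move=> y x [z] /[dup] /asboolP[d zd] zK; apply: Kpre_trans zd. Qed.

Fact K_display : Order.disp_t. Proof. exact: (Order.Disp tt tt). Qed.

HB.instance Definition _ :=
  Order.Le_isPOrder.Build K_display K K_le_refl K_le_anti K_le_trans.

End Poset.

Local Open Scope classical_set_scope.
Local Open Scope order_scope.

(* K_n^d as a subset of K_n. *)
Definition Klevel n (d : nat) : set (K n) := [set x | val x \in Kfin n d].
Arguments Klevel : clear implicits.

Lemma in_Klevel n (x : K n) : exists d, Klevel n d x.
Proof. by case: x => x xK; apply/asboolP. Qed.

Section DownSets.
Variable n : nat.

Definition decreasing_set (a : set (K n)) : Prop :=
  forall x y, x <= y -> a y -> a x.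

Definition is_decreasing : {pred set (K n)} := fun a => `[< decreasing_set a >].

Lemma is_decreasing_meet : meet_closed is_decreasing.
Proof.
move=> a b /asboolP da /asboolP db; apply/asboolP => x y xy [ay yb].
by split; [apply: da ay | apply: db yb].
Qed.

Lemma is_decreasing_join : join_closed is_decreasing.
Proof.
move=> a b /asboolP da /asboolP db; apply/asboolP => x y xy [ay|yb].
  by left; apply: da ay.
by right; apply: db yb.
Qed.

Lemma is_decreasing_bot : \bot \in is_decreasing.
Proof. exact/asboolP. Qed.

Lemma is_decreasing_top : \top \in is_decreasing.
Proof. exact/asboolP. Qed.

HB.instance Definition _ := Order.isTBLatticeClosed.Build _ _ is_decreasing
  is_decreasing_meet is_decreasing_join is_decreasing_bot is_decreasing_top.

(* The algebra \widehat{F_n}: its bounded lattice structure is inherited from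
   that of [set (K n)], so `&` is intersection, `|` is union, \bot is set0 and
   \top is setT. *)
Definition Fhat := {a : set (K n) | a \in is_decreasing}.
HB.instance Definition _ := [isSub of Fhat for @sval _ _].
HB.instance Definition _ := [Choice of Fhat by <:].
Fact Fhat_display : Order.disp_t. Proof. exact: (Order.Disp tt tt). Qed.
HB.instance Definition _ :=
  [SubChoice_isTBSubLattice of Fhat by <: with Fhat_display].

Definition himpl_set (a b : Fhat) : set (K n) :=
  \bigcup_(c in [set c | decreasing_set c /\
                         c `<=` (~` val a `|` val b)%classic]) c.

Lemma himpl_subproof a b : himpl_set a b \in is_decreasing.
Proof.
by apply/asboolP => x y xy [c [dc cab] cy]; exists c => //; apply: dc cy.
Qed.

Definition himpl (a b : Fhat) : Fhat :=
  exist (fun c => c \in is_decreasing) _ (himpl_subproof a b).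

Lemma himplP (a b c : Fhat) : (c <= himpl a b) = (c `&` a <= b).
Proof.
apply/idP/idP => /subsetPset cab; apply/subsetPset => x.
  by case=> /cab[e [_ eab] /eab[]].
move=> cx; exists (val c) => //; split; first exact/asboolP/(valP c).
by move=> y cy; have [ay|] := pselect (val a y); [right; apply: cab|left].
Qed.

Definition heyting_subalgebra (H : set Fhat) : Prop :=
  [/\ H \bot, H \top,
      forall a b, H a -> H b -> H (a `&` b)%O,
      forall a b, H a -> H b -> H (a `|` b)%O &
      forall a b, H a -> H b -> H (himpl a b)].

End DownSets.

Section Metric.
Variables (R : realType) (n : nat).
Implicit Types a b c : Fhat n.

Definition separated_at a b (i : nat) : bool :=
  `[< (val a `&` Klevel n i)%classic <> (val b `&` Klevel n i)%classic >].

Definition Fhat_dist a b : R :=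
  if pselect (exists i, separated_at a b i) is left h then
    (2%:R ^- (ex_minn h))%R
  else 0%R.

Lemma Fhat_dist_ge0 a b : (0 <= Fhat_dist a b)%R.
Proof.
by rewrite /Fhat_dist; case: pselect => // h; rewrite invr_ge0 exprn_ge0.
Qed.

Lemma separated_atC a b : separated_at a b =1 separated_at b a.
Proof. by move=> i; apply: asbool_equiv_eq; split => h /esym. Qed.

Lemma Fhat_distxx a : Fhat_dist a a = 0%R.
Proof. by rewrite /Fhat_dist; case: pselect => // h; exfalso; case: h => i /asboolP. Qed.

Lemma Fhat_dist_positivity a b : Fhat_dist a b = 0%R -> a = b.
Proof.
rewrite /Fhat_dist; case: pselect => [h /eqP|h _].
  by rewrite invr_eq0 expf_eq0 pnatr_eq0 andbF.
apply/val_inj/seteqP; split => x xa.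
all: have [d xd] := in_Klevel x.
all: have /asboolPn/contrapT/seteqP[ab ba] : ~~ separated_at a b d
  by apply/negP => s; apply: h; exists d.
- by have [] := ab x (conj xa xd).
- by have [] := ba x (conj xa xd).
Qed.

Lemma Fhat_dist_sym a b : Fhat_dist a b = Fhat_dist b a.
Proof.
rewrite /Fhat_dist; case: pselect => [h|h]; case: pselect => [h'|h'] //.
- by congr (_ ^- _)%R; apply: eq_ex_minn; apply: separated_atC.
- by case: h'; case: h => i; rewrite separated_atC; exists i.
- by case: h; case: h' => i; rewrite separated_atC; exists i.
Qed.

Lemma Fhat_dist_triangle b a c :
  (Fhat_dist a c <= Fhat_dist a b + Fhat_dist b c)%R.
Proof.
have sep i : separated_at a c i -> separated_at a b i || separated_at b c i.
  move=> /asboolP ac; apply/orP.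
  have [ab|/negP/asboolP/contrapT ab] := pselect (separated_at a b i).
    by left.
  by right; apply/asboolP; rewrite -ab.
have dist_ge u v i : separated_at u v i -> (2%:R ^- i <= Fhat_dist u v)%R.
  move=> s; rewrite /Fhat_dist; case: pselect => [h|[]]; last by exists i.
  case: ex_minnP => m _ /(_ _ s) mi.
  by rewrite lef_pV2 ?posrE ?exprn_gt0 // ler_weXn2l ?ler1n.
rewrite {1}/Fhat_dist; case: pselect => [h|_]; last first.
  by rewrite addr_ge0 ?Fhat_dist_ge0.
case: ex_minnP => m /sep/orP[s|s] _.
  by rewrite (le_trans (dist_ge _ _ _ s)) // lerDl Fhat_dist_ge0.
by rewrite (le_trans (dist_ge _ _ _ s)) // lerDr Fhat_dist_ge0.
Qed.

(* Copy of Fhat n carrying the R-valued metric; the parameter R cannot be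
   recovered from [Fhat n] itself. *)
Definition Fhat_metric (_ : realType) (m : nat) : Type := Fhat m.
HB.instance Definition _ := Choice.on (Fhat_metric R n).
HB.instance Definition _ := @isMetric.Build R (Fhat_metric R n) Fhat_dist
  Fhat_distxx Fhat_dist_positivity Fhat_dist_sym Fhat_dist_triangle.

(* "H is dense in \widehat{F_n}". *)
Definition dense_in_Fhat (H : set (Fhat n)) : Prop :=
  heyting_subalgebra H /\ dense (H : set (Fhat_metric R n)).

End Metric.

(* [join_irreducible_in H a]: a is an irreducible element of the sublattice H of
   L, where H has the same bottom as L. *)
Definition join_irreducible_in d (L : bLatticeType d) (H : set L) (a : L) :
    Prop :=
  [/\ H a, a <> \bot &
      ~ exists b1 b2, [/\ H b1, H b2, a = (b1 `|` b2)%O, b1 <> a & b2 <> a]].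

(* Main.v *)
Require Import Defs.
From HB Require Import structures.
From mathcomp Require Import all_boot all_order all_algebra.
From mathcomp Require Import all_classical all_reals all_analysis.
From mathcomp Require Import finmap.

(* A decreasing set contained in K_n^d is isolated in the metric, because a point
   outside K_n^d always lies above a point of exact level d+1; hence it belongs
   to the dense subalgebra H.  In particular H contains the principal ideal of
   each x and that ideal deprived of x, so it also contains their implication,
   which is the largest decreasing set avoiding x.  Now if a is the union of b1
   and b2, with x in a but not in b1 and y in a but not in b2, intersecting a
   with the largest decreasing sets avoiding x and y splits a inside H. *)

Set Implicit Arguments.
Unset Strict Implicit.
Unset Printing Implicit Defensive.

Import Order.TTheory GRing.Theory Num.Theory.

Local Open Scope classical_set_scope.
Local Open Scope order_scope.

Lemma Kpre_homo n : {homo @Kpre n : i j / (i <= j)%N >-> {subset i <= j}}.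
Proof.
move=> i j /subnKC <-; elim: (j - i)%N => [|m IH]; first by rewrite addn0.
by move=> x /IH xK; rewrite addnS; apply/in_KpreS; left.
Qed.

(** Induction on the stage [m]. If [x] first appears just after stage [k], it is its own witness. If
    it appears later, condition (i) gives its set [Y] an element outside the preceding stage, hence
    outside stage [k], and the induction descends to it. *)
Lemma Kpre_exact_level n k m (x : pt n) : x \in Kpre n m -> x \notin Kpre n k ->
  exists y, [/\ pt_le y x, y \in Kpre n k.+1 & y \notin Kpre n k].
Proof.
elim: m x => [|m IH] x; first by rewrite inE.
move=> xK; move: (xK) => /in_KpreS[/IH//|[[b Y] xE adm] xk].
have [km|mk] := ltnP k m; last first.
  exists x; split=> //; first by rewrite /pt_le eqxx orbT.
  exact: (Kpre_homo _ xK).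
case: m => [|m] in IH xK adm km *; first by [].
case/and5P: (adm) => /fsubsetP YB _ /fsubsetPn[u uY uA] _ _.
have uk : u \notin Kpre n k by apply: contra uA; apply: Kpre_homo.
have [y [yu yk1 yk]] := IH u (YB _ uY) uk.
exists y; split => //; apply: (Kpre_trans xK yu).
by rewrite xE; apply/orP; left.
Qed.

Lemma Klevel_exact_level n d (x : K n) : ~ Klevel n d x ->
  exists y, [/\ y <= x, Klevel n d.+1 y & ~ Klevel n d y].
Proof.
have [e xe] := in_Klevel x.
move=> /negP /(Kpre_exact_level xe)[y [yx yd1 yd]].
have yK : in_K y by apply/asboolP; exists d.+1.
by exists (exist _ y yK); split => //; apply/negP.
Qed.

Lemma Klevel_leq n d (x y : K n) : x <= y -> Klevel n d y -> Klevel n d x.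
Proof. by move=> /orP[xy yd|/eqP/val_inj-> //]; apply: Kpre_below yd _ xy. Qed.

(** A separation at [i] bounds the least separating index by [i], so the distance is at least
    [2 ^- i]; strictness is what gives agreement at [i] itself. *)
Lemma Fhat_dist_lt (R : realType) n (a b : Fhat n) i :
  (Fhat_dist R a b < 2%:R ^- i)%R -> val a `&` Klevel n i = val b `&` Klevel n i.
Proof.
move=> ab; apply: contrapT => /asboolP s; move: ab; apply/negP; rewrite -leNgt.
rewrite /Fhat_dist; case: pselect => [h|[]]; last by exists i.
case: ex_minnP => m _ /(_ _ s) mi.
by rewrite lef_pV2 ?posrE ?exprn_gt0 // ler_weXn2l ?ler1n.
Qed.

Lemma finite_level_isolated (R : realType) n d (c b : Fhat n) :
  val c `<=` Klevel n d -> (Fhat_dist R c b < 2%:R ^- d.+1)%R -> b = c.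
Proof.
move=> cd /Fhat_dist_lt /seteqP[cb bc].
have bd : val b `<=` Klevel n d.
  (* A point of [b] outside level [d] would put a point of exact level [d.+1] in [b], hence in [c];
     this is why the radius involves [d.+1]. *)
  move=> z bz; apply: contrapT => /Klevel_exact_level[y [yz yd1]]; apply.
  apply: cd; have [] // := bc y; split => //.
  exact: (asboolP _ (valP b)) yz bz.
have dS x : Klevel n d x -> Klevel n d.+1 x by apply: Kpre_homo.
apply/val_inj/seteqP; split => x xx.
  by have [] := bc x (conj xx (dS _ (bd _ xx))).
by have [] := cb x (conj xx (dS _ (cd _ xx))).
Qed.

Lemma dense_finite_level (R : realType) n (H : set (Fhat n)) d (c : Fhat n) :
  dense_in_Fhat R H -> val c `<=` Klevel n d -> H c.
Proof.
move=> [_ densH] cd.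
pose B : set (Fhat_metric R n) := ball (c : Fhat_metric R n) (2%:R ^- d.+1)%R.
have B_c : nbhs (c : Fhat_metric R n) B.
  by apply: nbhsx_ballx; rewrite invr_gt0 exprn_gt0.
(* Density speaks of nonempty open sets, hence the interior of the ball. *)
have [||b [bB Hb]] := densH B°.
- by exists c; apply: B_c.
- exact: open_interior.
suff <- : b = c by [].
by move/interior_subset: bB => cb; apply: finite_level_isolated cd cb.
Qed.

Section Avoid.
Variables (n : nat) (x : K n).

Fact ideal_subproof : [set y | y <= x] \in @is_decreasing n.
Proof. by apply/asboolP => y z yz; apply: le_trans. Qed.

Fact strict_ideal_subproof : [set y | y < x] \in @is_decreasing n.
Proof. by apply/asboolP => y z yz; apply: le_lt_trans. Qed.

Definition ideal : Fhat n :=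
  exist (fun c => c \in @is_decreasing n) _ ideal_subproof.
Definition strict_ideal : Fhat n :=
  exist (fun c => c \in @is_decreasing n) _ strict_ideal_subproof.

Definition avoid : Fhat n := himpl ideal strict_ideal.

(** By the Heyting adjunction [c <= avoid] says that [c] meets the ideal of [x] inside the strict
    ideal, and these two differ only in [x]. *)
Lemma avoidP (c : Fhat n) : reflect (~ val c x) (c <= avoid).
Proof.
rewrite himplP; apply: (iffP (subsetPset _ _)) => [cx xc|xc y [/= cy yx]].
  by have := cx x (conj xc (lexx x)); rewrite /= ltxx.
rewrite lt_neqAle yx andbT; apply/eqP => yxE; apply: xc.
by rewrite -yxE.
Qed.

Lemma dense_avoid (R : realType) (H : set (Fhat n)) :
  dense_in_Fhat R H -> H avoid.
Proof.
move=> hH; have [[_ _ _ _ Himpl] _] := hH.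
have [d xd] := in_Klevel x.
apply: Himpl; apply: (dense_finite_level (d := d) hH) => y /=.
  by move=> yx; apply: Klevel_leq xd.
by move=> /ltW yx; apply: Klevel_leq xd.
Qed.

End Avoid.

Lemma Fhat_lt_witness n (a b : Fhat n) : b <= a -> b <> a ->
  exists2 x, val a x & ~ val b x.
Proof.
move=> ba nab; apply: contrapT => nx; apply: nab; apply/le_anti; rewrite ba /=.
by apply/subsetPset => x ax; apply: contrapT => bx; apply: nx; exists x.
Qed.

Theorem corollary7p2 (R : realType) (n : nat) (hn : (1 <= n)%N)
    (H : set (Fhat n)) (hH : dense_in_Fhat R H)
    (a : Fhat n) (ha : join_irreducible_in H a) :
  join_irreducible_in setT a.
Proof.
have [Ha a0 irr] := ha; split => // -[b1 [b2 [_ _ aE b1a b2a]]]; apply: irr.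
have b1_le : b1 <= a by rewrite aE leUl.
have b2_le : b2 <= a by rewrite aE leUr.
have [x ax /avoidP b1x] := Fhat_lt_witness b1_le b1a.
have [y ay /avoidP b2y] := Fhat_lt_witness b2_le b2a.
have [[_ _ Hmeet _ _] _] := hH.
have proper z : val a z -> a `&` avoid z <> a.
  by move=> az /meet_idPl/avoidP.
exists (a `&` avoid x), (a `&` avoid y); split; try exact: proper.
- exact/Hmeet/(dense_avoid x hH).
- exact/Hmeet/(dense_avoid y hH).
(* Since [b1] misses [x] and [b2] misses [y], each lies in the corresponding new piece, so the
   pieces cover [a]. *)
- apply/le_anti; rewrite leUx !leIl !andbT {1}aE.
  by apply: leU2; rewrite lexI ?b1_le ?b2_le.
Qed.
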